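(* Let $p>3$ be prime, let $a,b\in\mathbb{Q}_p$ with $ab\neq 0$, and suppose $(a,b)\in\Delta_1\cup\Delta_3$. Consider the cubic equation $x^3+ax=b$ over $\mathbb{Q}_p$. Then: 1. It is solvable in $(\mathbb{Z}_p^* )^{[3]}$ iff $(a,b)\in\Delta_1$, $|b|_p=1$ and $p\equiv 1 \pmod 3$. 2. It is solvable in $(\mathbb{Z}_p\setminus\mathbb{Z}_p^* )^{[3]}$ iff either [$(a,b)\in\Delta_1$, $|b|_p<1$, $p\equiv 1\pmod 3$] or [$(a,b)\in\Delta_3$, $|a|_p<1$, $\sqrt{-a}$ exists]. 3. It is solvable in $(\mathbb{Q}_p\setminus\mathbb{Z}_p)^{[3]}$ iff either [$(a,b)\in\Delta_1$, $|b|_p>1$, $p\equiv 1\pmod 3$] or [$(a,b)\in\Delta_3$, $|b|_p>|a|_p$, $\sqrt{-a}$ exists]. 4. It is solvable in $(\mathbb{Z}_p\setminus\mathbb{Z}_p^* )^{[1]}\sqcup(\mathbb{Z}_p^* )^{[2]}$ iff $(a,b)\in\Delta_3$, $|a|_p=1$ and $\sqrt{-a}$ exists. 5. It is solvable in $(\mathbb{Z}_p^* )^{[1]}\sqcup(\mathbb{Q}_p\setminus\mathbb{Z}_p)^{[2]}$ iff $(a,b)\in\Delta_3$, $|a|_p=|b|_p$ and $\sqrt{-a}$ exists. 6. It is solvable in $(\mathbb{Z}_p\setminus\mathbb{Z}_p^* )^{[1]}\sqcup(\mathbb{Q}_p\setminus\mathbb{Z}_p)^{[2]}$ iff $(a,b)\in\Delta_3$,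 $|a|_p>|b|_p$, $|a|_p>1$ and $\sqrt{-a}$ exists. 7. It is solvable in $(\mathbb{Z}_p^* )^{[1]}$ iff either [$(a,b)\in\Delta_1$, $|b|_p=1$, $p\equiv 2\pmod 3$] or [$(a,b)\in\Delta_3$, $|a|_p=|b|_p$, $\sqrt{-a}$ does not exist]. 8. It is solvable in $(\mathbb{Z}_p\setminus\mathbb{Z}_p^* )^{[1]}$ iff either [$(a,b)\in\Delta_1$, $|b|_p<1$, $p\equiv 2\pmod 3$] or [$(a,b)\in\Delta_3$, $|a|_p>|b|_p$, $\sqrt{-a}$ does not exist]. 9. It is solvable in $(\mathbb{Q}_p\setminus\mathbb{Z}_p)^{[1]}$ iff either [$(a,b)\in\Delta_1$, $|b|_p>1$, $p\equiv 2\pmod 3$] or [$(a,b)\in\Delta_3$, $|a|_p<|b|_p$, $\sqrt{-a}$ does not exist].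
   Context: $\mathbb{Z}_p=\{x\in\mathbb{Q}_p:|x|_p\le1\}$, $\mathbb{Z}_p^*=\{x:|x|_p=1\}$. Every nonzero $c\in\mathbb{Q}_p$ is written $c=c^*/|c|_p$ with $c^*\in\mathbb{Z}_p^*$, $c^*=c_0+c_1p+c_2p^2+\cdots$, $c_0\in\{1,\dots,p-1\}$, $c_i\in\{0,\dots,p-1\}$. For nonzero $c$: ''$\sqrt{c}$ exists'' means $c_0^{(p-1)/2}\equiv 1\pmod p$ and $\log_p|c|_p$ is even; ''$\sqrt[3]{c}$ exists'' means $c_0^{(p-1)/\gcd(3,p-1)}\equiv 1\pmod p$ and $\log_p|c|_p$ is divisible by $3$ (equivalently, $x^2=c$, resp. $x^3=c$, is solvable in $\mathbb{Q}_p$). With $a_0,b_0$ the leading digits of $a^*,b^*$: $D_0=-4a_0^3-27b_0^2$, and integers $u_n$ are defined by $u_1=0,\ u_2=-a_0,\ u_3=b_0,\ u_{n+3}=b_0u_n-a_0u_{n+1}$. Sets: $\Delta_1=\{(a,b): |a|_p^3<|b|_p^2,\ \sqrt[3]{b}\text{ exists}\}$, $\Delta_2=\{(a,b): |a|_p^3=|b|_p^2,\ D_0u_{p-2}^2\not\equiv 9a_0^2 \pmod p\}$, $\Delta_3=\{(a,b): |a|_p^3>|b|_p^2\}$. Roots of $x^3+ax=b$ are taken in $\mathbb{Q}_p$ and counted with multiplicity. For $A\subset\mathbb{Q}_p$ and $n\in\{1,3\}$, ''solvable in $A^{[n]}$'' means the equation has exactly $n$ roots in $\mathbb{Q}_p$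 (with multiplicity) and all lie in $A$. For disjoint $A,B$ and $m,n>0$, $m+n=3$, ''solvable in $A^{[n]}\sqcup B^{[m]}$'' means exactly $n$ of its roots (with multiplicity) lie in $A$ and exactly $m$ lie in $B$. *)

(* Defs.v *)
From HB Require Import structures.
From mathcomp Require Import all_boot all_order all_algebra.
Set Implicit Arguments. Unset Strict Implicit. Unset Printing Implicit Defensive.
Import Order.TTheory GRing.Theory Num.Theory.
Local Open Scope ring_scope.

(* The field Q_p of p-adic numbers, given by its standard characterization *)
(* (unique up to isometric isomorphism): a field K with a norm nK : K -> Q *)
(* (the p-adic absolute value |.|_p) that is non-archimedean,              *)
(* multiplicative, with |p| = 1/p, in which Q is dense, and which is       *)
(* complete.                                                               *)
Record is_Qp (p : nat) (K : fieldType) (nK : K -> rat) : Prop := IsQp {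
  Qp_norm_ge0 : forall x, 0 <= nK x;
  Qp_norm_eq0 : forall x, nK x = 0 <-> x = 0;
  Qp_normM : forall x y, nK (x * y) = nK x * nK y;
  Qp_ultra : forall x y, nK (x + y) <= Num.max (nK x) (nK y);
  Qp_norm_p : nK (p%:R) = (p%:R)^-1;
  Qp_dense : forall (x : K) (eps : rat), 0 < eps ->
     exists r : rat, nK (x - ratr r) < eps;
  Qp_complete : forall u : nat -> K,
     (forall eps : rat, 0 < eps -> exists N, forall m n, (N <= m)%N -> (N <= n)%N ->
         nK (u m - u n) < eps) ->
     exists l : K, forall eps : rat, 0 < eps -> exists N, forall n, (N <= n)%N ->
         nK (u n - l) < eps
}.

Section Padic.
Variables (p : nat) (K : fieldType) (nK : K -> rat).

(* c^* = c / |c|_p = c * |c|_p (as |c|_p is rational) ; its leading digit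
   c_0 in {1,..,p-1} is the unique digit with |c^* - c_0|_p < 1. *)
Definition unit_part (c : K) : K := c * ratr (nK c).
Definition lead_digit (c : K) (d : nat) : Prop :=
  (0 < d < p)%N /\ nK (unit_part c - d%:R) < 1.

Definition log_norm (c : K) (k : int) : Prop := nK c = (p%:R : rat) ^ k.

Definition sqrt_exists (c : K) : Prop :=
  c != 0 /\ exists (d : nat) (k : int),
    [/\ lead_digit c d, (d ^ ((p - 1) %/ 2) %% p = 1)%N,
        log_norm c k & (2 %| k)%Z].

Definition cbrt_exists (c : K) : Prop :=
  c != 0 /\ exists (d : nat) (k : int),
    [/\ lead_digit c d, (d ^ ((p - 1) %/ gcdn 3 (p - 1)) %% p = 1)%N,
        log_norm c k & (3 %| k)%Z].

Definition Delta1 (a b : K) : Prop := nK a ^+ 3 < nK b ^+ 2 /\ cbrt_exists b.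
Definition Delta3 (a b : K) : Prop := nK a ^+ 3 > nK b ^+ 2.

Definition cubic (a b : K) : {poly K} := 'X^3 + a%:P * 'X - b%:P.

Definition root_multiset (P : {poly K}) (s : seq K) : Prop :=
  forall x, count_mem x s = mup x P.

Definition solvable_in (P : {poly K}) (A : pred K) (n : nat) : Prop :=
  exists s, root_multiset P s /\ size s = n /\ all A s.

Definition solvable_in2 (P : {poly K}) (A : pred K) (n : nat) (B : pred K) (m : nat) : Prop :=
  exists s, root_multiset P s /\ count A s = n /\ count B s = m.

Definition Zp_units : pred K := fun x => nK x == 1.
Definition Zp_nonunits : pred K := fun x => nK x < 1.
Definition Qp_nonint : pred K := fun x => 1 < nK x.

End Padic.

(* Main.v *)
Require Import Defs.
From HB Require Import structures.
From mathcomp Require Import all_boot all_order all_algebra.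
From mathcomp Require Import all_fingroup all_solvable all_field.
From mathcomp Require Import ring.
Set Implicit Arguments. Unset Strict Implicit. Unset Printing Implicit Defensive.
Import Order.TTheory GRing.Theory Num.Theory.
Local Open Scope ring_scope.

(* Hensel lifting produces one root r of the cubic: when |a|^3 < |b|^2 we scale
   by a cube root of b and lift the root 1 of z^3 = 1, and when |a|^3 > |b|^2 we
   scale by b/a and lift the root 1 of z = 1.  The other two roots exist iff
   -3r^2 - 4a, the discriminant of the quadratic cofactor, is a square.  This
   discriminant is close to -3r^2 in the first case and to -4a in the second,
   and a small relative perturbation does not affect being a square; so the
   criterion is that -3 is a square, i.e. p = 1 mod 3, respectively that -a is a
   square.  The norms of the roots are |b|^(1/3) in the first case, and |b|/|a|,
   |a|^(1/2), |a|^(1/2) in the second. *)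

Lemma prime_mod3_eq2 (p : nat) : prime p -> (3 < p)%N ->
  (p %% 3 = 2)%N <-> (p %% 3 != 1)%N.
Proof.
move=> p_pr p_gt3; have : (p %% 3 < 3)%N by rewrite ltn_mod.
have : (p %% 3 != 0)%N by rewrite -/(3 %| p)%N dvdn_prime2 // neq_ltn p_gt3.
by case: (p %% 3)%N => [|[|[|]]].
Qed.

Lemma divr_eq1 (F : fieldType) (x y : F) : y != 0 -> (x / y == 1) = (x == y).
Proof. by move=> y_neq0; rewrite -{1}(divff y_neq0) (inj_eq (mulIf _)) ?invr_eq0. Qed.

(** * Powers in finite fields *)

Definition is_power (R : pzSemiRingType) (n : nat) (x : R) : Prop :=
  exists y, y ^+ n = x.

Lemma is_powerMX (F : fieldType) (n : nat) (x w : F) : w != 0 ->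
  is_power n (x * w ^+ n) <-> is_power n x.
Proof.
move=> w_neq0; split=> [[y yx]|[y <-]]; last by exists (y * w); rewrite exprMn.
by exists (y / w); rewrite exprMn exprVn yx mulfK // expf_neq0.
Qed.

Lemma cyclic_powerP (gT : finGroupType) (G : {group gT}) (x : gT) (n : nat) :
    cyclic G -> x \in G ->
  reflect (exists2 y, y \in G & (y ^+ n = x)%g)
          (x ^+ (#|G| %/ gcdn n #|G|) == 1)%g.
Proof.
move=> /cyclicP cycG Gx; apply: (equivP idP); case: cycG Gx => z -> zx.
rewrite -order_dvdn gcdnC -orderXgcd /order.
rewrite (cardSg_cyclic (cycle_cyclic z)) ?cycle_subG ?mem_cycle //.
split=> [/cycleP[k ->]|[_ /cycleP[k ->] <-]].
  by exists (z ^+ k)%g; rewrite ?mem_cycle // -!expgM mulnC.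
by apply/cycleP; exists k; rewrite -!expgM mulnC.
Qed.

Lemma finField_powerP (F : finFieldType) (x : F) (n : nat) :
    (0 < n)%N -> x != 0 ->
  reflect (is_power n x) (x ^+ (#|F|.-1 %/ gcdn n #|F|.-1) == 1).
Proof.
move=> n_gt0 x_neq0; pose u := finField_unit x_neq0.
rewrite -[x]/(val u) -FinRing.val_unitX -card_finField_unit.
rewrite -[1]/(val (1%g : {unit F})) val_eqE.
apply: (iffP (cyclic_powerP n (field_unit_group_cyclic _) (in_setT u))).
  by case=> y _ <-; exists (val y); rewrite FinRing.val_unitX.
case=> y; have [->|y_neq0 yx] := eqVneq y 0.
  by move/eqP; rewrite expr0n gtn_eqF // eq_sym (negPf x_neq0).
exists (finField_unit y_neq0); rewrite ?inE //.
by apply: val_inj; rewrite FinRing.val_unitX.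
Qed.

Lemma Fp_powerP (p n d : nat) : prime p -> (0 < n)%N -> ~~ (p %| d)%N ->
  reflect (is_power n (d%:R : 'F_p))
          (d ^ ((p - 1) %/ gcdn n (p - 1)) %% p == 1)%N.
Proof.
move=> p_pr n_gt0 p'd; have d_neq0 : d%:R != 0 :> 'F_p.
  by rewrite -(dvdn_pcharf (pchar_Fp p_pr)).
have := finField_powerP n_gt0 d_neq0; rewrite card_Fp // -subn1 -natrX.
by rewrite -val_eqE /= val_Fp_nat // modn_small // prime_gt1.
Qed.

Lemma is_power2N3_cyclotomic (F : fieldType) : 2%:R != 0 :> F ->
  is_power 2 (- 3%:R : F) <-> exists w : F, w ^+ 2 + w + 1 = 0.
Proof.
move=> nz2; split=> [[y y2]|[w w_root]].
  exists ((y - 1) / 2%:R).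
  have -> : ((y - 1) / 2%:R) ^+ 2 + (y - 1) / 2%:R + 1
            = (y ^+ 2 + 3%:R) / 2%:R / 2%:R by field.
  by rewrite y2 addNr !mul0r.
exists (2%:R * w + 1).
have -> : (2%:R * w + 1) ^+ 2 = 4%:R * (w ^+ 2 + w + 1) - 3%:R by ring.
by rewrite w_root mulr0 add0r.
Qed.

Lemma finField_cyclotomic3P (F : finFieldType) : 3%:R != 0 :> F ->
  (exists w : F, w ^+ 2 + w + 1 = 0) <-> (3 %| #|F|.-1)%N.
Proof.
move=> nz3; rewrite -card_finField_unit.
have cubeB1 (w : F) : (w - 1) * (w ^+ 2 + w + 1) = w ^+ 3 - 1 by ring.
split=> [[w w_root]|].
  have w3 : w ^+ 3 = 1 by apply/eqP; rewrite -subr_eq0 -cubeB1 w_root mulr0.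
  have w_neq1 : w != 1.
    by apply: contra_neq nz3 => w1; rewrite -w_root w1; ring.
  have w_neq0 : w != 0.
    by apply: contra_eq_neq w3 => ->; rewrite expr0n eq_sym oner_neq0.
  have <- : #[finField_unit w_neq0]%g = 3%N.
    apply: nt_prime_order; rewrite // -?val_eqE //; apply: val_inj.
    by rewrite FinRing.val_unitX.
  by rewrite order_dvdG ?inE.
case/(Cauchy (isT : prime 3)) => u _ u_order.
have u3 : val u ^+ 3 = 1 by rewrite -FinRing.val_unitX -u_order expg_order.
have u_neq1 : val u - 1 != 0.
  by rewrite subr_eq0 -[1]/(val (1%g : {unit F})) val_eqE -order_eq1 u_order.
by exists (val u); apply: (mulfI u_neq1); rewrite cubeB1 u3 subrr mulr0.
Qed.

(** * Non-archimedean absolute values *)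

Lemma bernoulli (R : numDomainType) (h : R) (n : nat) :
  0 <= h -> 1 + h *+ n <= (1 + h) ^+ n.
Proof.
move=> h_ge0; elim: n => [|n IHn]; first by rewrite mulr0n addr0.
rewrite mulrS addrCA exprS mulrDl mul1r addrC lerD //.
by rewrite ler_peMr // exprn_ege1 // lerDl.
Qed.

Lemma exprn_lt_eps (R : archiRealFieldType) (x eps : R) :
  0 <= x < 1 -> 0 < eps -> exists n, x ^+ n < eps.
Proof.
case/andP=> x_ge0 x_lt1 eps_gt0; have [->|x_neq0] := eqVneq x 0; first by exists 1.
have x_gt0 : 0 < x by rewrite lt_def x_neq0.
have h_gt0 : 0 < x^-1 - 1 by rewrite subr_gt0 invf_gt1.
exists (Num.bound (eps^-1 / (x^-1 - 1))).
rewrite -ltf_pV2 ?posrE ?exprn_gt0 // -exprVn.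
have := bernoulli (Num.bound (eps^-1 / (x^-1 - 1))) (ltW h_gt0).
rewrite subrKC; apply: lt_le_trans; rewrite ltr_pwDl // -mulr_natl.
by rewrite -ler_pdivrMr // ltW // archi_boundP // divr_ge0 ?invr_ge0 ?ltW.
Qed.

Lemma le_geometric_le0 (R : archiRealFieldType) (c x m : R) :
  0 <= c < 1 -> (forall n, x <= m * c ^+ n) -> x <= 0.
Proof.
move=> c01 x_le; rewrite leNgt; apply/negP => x_gt0.
have m_gt0 : 0 < m by have := x_le 0; rewrite expr0 mulr1; apply: lt_le_trans.
have [n] := exprn_lt_eps c01 (divr_gt0 x_gt0 m_gt0).
by rewrite ltr_pdivlMr // mulrC ltNge x_le.
Qed.

Structure nonarch_abv (K : fieldType) (R : realFieldType) := NonarchAbv {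
  abv_fun :> K -> R;
  abv_ge0 : forall x, 0 <= abv_fun x;
  abv_eq0P : forall x, abv_fun x = 0 <-> x = 0;
  abvM : {morph abv_fun : x y / x * y};
  abvD_max : forall x y, abv_fun (x + y) <= Num.max (abv_fun x) (abv_fun y)
}.

Section NonarchAbv.
Variables (K : fieldType) (R : realFieldType) (v : nonarch_abv K R).
Implicit Types (x y : K) (c : R) (n : nat).

Lemma abv_eq0 x : (v x == 0) = (x == 0).
Proof. by apply/eqP/eqP => /(abv_eq0P v). Qed.

Lemma abv0 : v 0 = 0.
Proof. exact/abv_eq0P. Qed.

Lemma abv_gt0 x : (0 < v x) = (x != 0).
Proof. by rewrite lt_def abv_eq0 abv_ge0 andbT. Qed.

Lemma abvX_gt_neq0 c x n : 0 <= c -> c < v x ^+ n.+1 -> x != 0.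
Proof.
move=> c_ge0; apply: contraTneq => ->.
by rewrite abv0 expr0n -leNgt.
Qed.

Lemma abv1 : v 1 = 1.
Proof.
have v1_neq0 : v 1 != 0 by rewrite abv_eq0 oner_eq0.
by apply: (mulfI v1_neq0); rewrite -abvM !mulr1.
Qed.

Lemma abvX n : {morph v : x / x ^+ n}.
Proof. by move=> x; elim: n => [|n IHn]; rewrite ?abv1 // !exprS abvM IHn. Qed.

Lemma abvN x : v (- x) = v x.
Proof.
rewrite -mulN1r abvM; suff -> : v (-1) = 1 by rewrite mul1r.
by apply/eqP; rewrite -(@pexpr_eq1 _ _ 2) ?abv_ge0 // -abvX sqrrN expr1n abv1.
Qed.

Lemma abvV : {morph v : x / x^-1}.
Proof.
move=> x; have [->|x_neq0] := eqVneq x 0; first by rewrite invr0 abv0 invr0.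
have vx_neq0 : v x != 0 by rewrite abv_eq0.
by apply: (mulfI vx_neq0); rewrite -abvM !divff // abv1.
Qed.

Lemma abv_div : {morph v : x y / x / y}.
Proof. by move=> x y; rewrite abvM abvV. Qed.

Lemma abvXz (k : int) : {morph v : x / x ^ k}.
Proof. by move=> x; case: k => n; rewrite ?NegzE -?exprnN -?exprnP ?abvV abvX. Qed.

Lemma abvBC x y : v (x - y) = v (y - x).
Proof. by rewrite -abvN opprB. Qed.

Lemma abvD_le x y c : v x <= c -> v y <= c -> v (x + y) <= c.
Proof. by move=> xc yc; apply: le_trans (abvD_max v x y) _; rewrite ge_max xc. Qed.

Lemma abvD_lt x y c : v x < c -> v y < c -> v (x + y) < c.
Proof. by move=> xc yc; apply: le_lt_trans (abvD_max v x y) _; rewrite gt_max xc. Qed.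

Lemma abvB_lt x y c : v x < c -> v y < c -> v (x - y) < c.
Proof. by move=> xc yc; rewrite abvD_lt ?abvN. Qed.

Lemma abvD_dominant x y : v x < v y -> v (x + y) = v y.
Proof.
move=> lt_xy; apply/eqP; rewrite eq_le abvD_le ?(ltW lt_xy) //= leNgt.
by apply/negP => /abvB_lt/(_ lt_xy); rewrite addrC addKr ltxx.
Qed.

Lemma abv_near x y : v (x - y) < v y -> v x = v y.
Proof. by move/abvD_dominant; rewrite subrK. Qed.

Lemma abv_near1 x : v (x - 1) < 1 -> v x = 1.
Proof. by rewrite -abv1 => /abv_near. Qed.

Lemma abv_absz (z : int) : v z%:~R = v (absz z)%:R.
Proof. by case: z => n; rewrite ?NegzE ?mulrNz ?abvN. Qed.

Definition valring : {pred K} := [pred x | v x <= 1].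

Lemma valringE x : (x \in valring) = (v x <= 1).
Proof. by []. Qed.

Lemma valring_subring_closed : subring_closed valring.
Proof.
split=> [|x y|x y]; rewrite !valringE ?abv1 // => x_le1 y_le1.
  by rewrite abvD_le ?abvN.
by rewrite abvM mulr_ile1 ?abv_ge0.
Qed.

HB.instance Definition _ :=
  GRing.isSubringClosed.Build K valring valring_subring_closed.

Lemma abvBX_lt1 x y n : v (x - y) < 1 -> v y <= 1 -> v (x ^+ n - y ^+ n) < 1.
Proof.
move=> xy Oy; have Ox : v x <= 1 by rewrite -(subrK y x) abvD_le // ltW.
rewrite subrXX abvM (le_lt_trans _ xy) // ler_piMr ?abv_ge0 //.
by apply: (@rpred_sum _ valring) => i _; rewrite rpredM ?rpredX.
Qed.
End NonarchAbv.

Definition abv_cvg (K : fieldType) (R : realFieldType) (v : K -> R)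
    (u : nat -> K) (l : K) : Prop :=
  forall eps, 0 < eps -> exists N, forall n, (N <= n)%N -> v (u n - l) < eps.

Definition abv_cauchy (K : fieldType) (R : realFieldType) (v : K -> R)
    (u : nat -> K) : Prop :=
  forall eps, 0 < eps -> exists N, forall m n, (N <= m)%N -> (N <= n)%N ->
    v (u m - u n) < eps.

Definition abv_complete (K : fieldType) (R : realFieldType) (v : K -> R) : Prop :=
  forall u, abv_cauchy v u -> exists l, abv_cvg v u l.

Section GeometricSequence.
Variables (K : fieldType) (R : archiRealFieldType) (v : nonarch_abv K R).
Variables (u : nat -> K) (c m : R).
Hypothesis c01 : 0 <= c < 1.
Hypothesis u_step : forall n, v (u n.+1 - u n) <= m * c ^+ n.

Let c_ge0 : 0 <= c. Proof. by case/andP: c01. Qed.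
Let c_lt1 : c < 1. Proof. by case/andP: c01. Qed.

Let m_ge0 : 0 <= m.
Proof. by have := le_trans (abv_ge0 v _) (u_step 0); rewrite expr0 mulr1. Qed.

Lemma geometric_tail N n : (N <= n)%N -> v (u n - u N) <= m * c ^+ N.
Proof.
move/subnKC => <-; elim: (n - N)%N => [|k IHk].
  by rewrite addn0 subrr abv0 mulr_ge0 ?exprn_ge0.
rewrite addnS -(subrKA (u (N + k)%N)) abvD_le // (le_trans (u_step _)) //.
by rewrite exprD mulrA ler_piMr ?mulr_ge0 ?exprn_ge0 // exprn_ile1 // ltW.
Qed.

Lemma geometric_cauchy : abv_cauchy v u.
Proof.
move=> eps eps_gt0; have m1_gt0 : 0 < m + 1 by rewrite ltr_wpDl.
have [N cN] := exprn_lt_eps c01 (divr_gt0 eps_gt0 m1_gt0).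
have mcN : m * c ^+ N < eps.
  apply: le_lt_trans (_ : (m + 1) * c ^+ N < eps).
    by rewrite ler_wpM2r ?exprn_ge0 // lerDl.
  by rewrite mulrC -ltr_pdivlMr.
exists N => i j Ni Nj; rewrite -(subrKA (u N)) abvD_lt //.
  exact: le_lt_trans (geometric_tail Ni) mcN.
by rewrite abvBC; apply: le_lt_trans (geometric_tail Nj) mcN.
Qed.

Lemma geometric_limit : abv_complete v ->
  exists l, forall n, v (l - u n) <= m * c ^+ n.
Proof.
move=> v_complete; have [l u_to_l] := v_complete u geometric_cauchy.
exists l => n; rewrite leNgt; apply/negP => lt_ln.
have [N uN] := u_to_l _ (le_lt_trans (mulr_ge0 m_ge0 (exprn_ge0 n c_ge0)) lt_ln).
suff : v (l - u n) < v (l - u n) by rewrite ltxx.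
rewrite -{1}(subrKA (u (maxn N n))) abvD_lt //.
  by apply: le_lt_trans (uN _ (leq_maxl N n)); rewrite abvBC.
exact: le_lt_trans (geometric_tail (leq_maxr N n)) lt_ln.
Qed.
End GeometricSequence.

(** * Hensel's lemma *)

Lemma polyOver_taylor2 (R : comNzSemiRingType) (S : semiringClosed R)
    (f : {poly R}) (x h : R) :
    f \is a polyOver S -> x \in S -> h \in S ->
  exists2 g, g \in S & f.[x + h] = f.[x] + f^`().[x] * h + g * h ^+ 2.
Proof.
move=> Sf Sx Sh; exists (\sum_(i < size f) f^`N(i.+2).[x] * h ^+ i).
  apply: rpred_sum => i _.
  by rewrite rpredM ?rpredX ?rpred_horner ?polyOver_nderivn.
rewrite (@nderiv_taylor_wide _ (size f).+2) ?leqW //; last exact: mulrC.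
rewrite !big_ord_recl /= nderivn0 expr0 mulr1 nderivn1 expr1 addrA mulr_suml.
congr (_ + _); apply: eq_bigr => i _; rewrite /bump /= !add1n.
by rewrite -mulrA -exprD addn2.
Qed.

Lemma polyOver_taylor1 (R : comNzSemiRingType) (S : semiringClosed R)
    (f : {poly R}) (x h : R) :
    f \is a polyOver S -> x \in S -> h \in S ->
  exists2 g, g \in S & f.[x + h] = f.[x] + g * h.
Proof.
move=> Sf Sx Sh; have [g Sg ->] := polyOver_taylor2 Sf Sx Sh.
exists (f^`().[x] + g * h); last by rewrite mulrDl expr2 mulrA addrA.
by rewrite rpredD ?rpredM // rpred_horner ?polyOver_deriv.
Qed.

Definition newton (K : fieldType) (f : {poly K}) (x : K) : K := x - f.[x] / f^`().[x].

Lemma newton_step (K : fieldType) (R : realFieldType) (v : nonarch_abv K R)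
    (f : {poly K}) (x : K) :
    f \is a polyOver (valring v) -> x \in valring v ->
    v f.[x] < v f^`().[x] ^+ 2 ->
  [/\ newton f x \in valring v, v (newton f x - x) = v f.[x] / v f^`().[x],
      v f^`().[newton f x] = v f^`().[x]
    & v f.[newton f x] <= (v f.[x] / v f^`().[x]) ^+ 2].
Proof.
move=> Of Ox fx_small; have Of' := polyOver_deriv Of.
have f'x_neq0 := abvX_gt_neq0 (abv_ge0 v _) fx_small.
have f'x_gt0 : 0 < v f^`().[x] by rewrite abv_gt0.
have f'x_le1 : v f^`().[x] <= 1 := rpred_horner Of' Ox.
pose h := - (f.[x] / f^`().[x]); have vh : v h = v f.[x] / v f^`().[x].
  by rewrite abvN abv_div.
have h_lt : v h < v f^`().[x] by rewrite vh ltr_pdivrMr.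
have Oh : h \in valring v by rewrite valringE (le_trans (ltW h_lt)).
rewrite /newton -/h [x + h]addrC addrK addrC -vh; split=> //; first exact: rpredD.
  have [g Og ->] := polyOver_taylor1 Of' Ox Oh.
  by rewrite addrC abvD_dominant // abvM (le_lt_trans _ h_lt) // ler_piMl ?abv_ge0.
have [g Og ->] := polyOver_taylor2 Of Ox Oh.
rewrite (_ : _ + _ * h = 0) ?add0r; last by rewrite /h mulrN mulrC divfK ?subrr.
by rewrite abvM abvX ler_piMl ?exprn_ge0 ?abv_ge0.
Qed.

Section Hensel.
Variables (K : fieldType) (R : archiRealFieldType) (v : nonarch_abv K R).
Variables (f : {poly K}) (x : K).
Hypotheses (Of : f \is a polyOver (valring v)) (Ox : x \in valring v).
Hypothesis fx_small : v f.[x] < v f^`().[x] ^+ 2.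

Let d := v f^`().[x].
Let c := v f.[x] / d ^+ 2.
Let u n := iter n (newton f) x.

Let d_gt0 : 0 < d.
Proof. by rewrite abv_gt0 (abvX_gt_neq0 (abv_ge0 v _) fx_small). Qed.

Let c01 : 0 <= c < 1.
Proof.
rewrite divr_ge0 ?abv_ge0 ?exprn_ge0 ?ltW //=.
by rewrite ltr_pdivrMr ?mul1r ?exprn_gt0.
Qed.

Lemma newton_iter n :
  [/\ u n \in valring v, v f^`().[u n] = d, v f.[u n] < d ^+ 2
    & v f.[u n] / d <= d * c * c ^+ n].
Proof.
have [c_ge0 c_lt1] := andP c01.
have dc_ge0 : 0 <= d * c := mulr_ge0 (ltW d_gt0) c_ge0.
elim: n => [|n [Ou f'u fu_small fu_le]].
  have dcE : d * c = v f.[x] / d by rewrite /c; field; rewrite gt_eqF.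
  by split; rewrite // expr0 mulr1 dcE.
clearbody c d; rewrite -f'u in fu_small.
have [Oz _ f'z fz_le] := newton_step Of Ou fu_small.
rewrite /u iterS -/(u n); move: (newton f (u n)) Oz f'z fz_le => z Oz f'z.
rewrite f'u in f'z * => fz_le; rewrite expr2 in fz_le.
have fz_geometric : v f.[z] / d <= d * c * c ^+ n.+1.
  have fu_le_dc : v f.[u n] / d <= d * c.
    by apply: le_trans fu_le (ler_piMr dc_ge0 _); rewrite exprn_ile1 // ltW.
  rewrite ler_pdivrMr // exprSr !mulrA mulrAC -mulrA; apply: le_trans fz_le _.
  by apply: (ler_pM _ _ fu_le fu_le_dc); rewrite divr_ge0 ?abv_ge0 ?ltW.
split=> //; rewrite expr2 -ltr_pdivrMr // (le_lt_trans fz_geometric) //.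
by rewrite -mulrA -exprS gtr_pMr // exprn_ilt1.
Qed.

Theorem hensel : abv_complete v -> exists2 y, root f y & v (y - x) < d.
Proof.
move=> v_complete; have step n : v (u n.+1 - u n) <= d * c * c ^+ n.
  have [Ou f'u fu_small fu_le] := newton_iter n; rewrite -f'u in fu_small.
  by have [_ -> _ _] := newton_step Of Ou fu_small; rewrite f'u.
have [l u_to_l] := geometric_limit c01 step v_complete.
have lx : v (l - x) < d.
  apply: le_lt_trans (u_to_l 0) _.
  by rewrite expr0 mulr1 gtr_pMr //; case/andP: c01.
have d_le1 : d <= 1 := rpred_horner (polyOver_deriv Of) Ox.
have Ol : l \in valring v.
  by rewrite -[l](subrK x) rpredD // valringE ltW // (lt_le_trans lx).
exists l => //; rewrite /root -(abv_eq0 v) eq_le abv_ge0 andbT.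
apply: (le_geometric_le0 c01 (m := d * c)) => n.
have [Ou _ _ fu_le] := newton_iter n.
have [g Og] := polyOver_taylor1 Of Ou (rpredB Ol Ou); rewrite subrKC => ->.
rewrite abvD_le //.
  by apply: le_trans fu_le; rewrite ler_pdivlMr // ler_piMr ?abv_ge0.
by rewrite abvM (le_trans _ (u_to_l n)) // ler_piMl ?abv_ge0.
Qed.
End Hensel.

Section PowerNear.
Variables (K : fieldType) (R : archiRealFieldType) (v : nonarch_abv K R).
Hypothesis v_complete : abv_complete v.
Implicit Types (x y : K) (n : nat).

Lemma power_near n x y : v (x - y) < v n%:R ^+ 2 * v y ->
  exists2 w, v w = 1 & x = y * w ^+ n.
Proof.
move=> xy; have y_gt0 : 0 < v y.
  rewrite abv_gt0; apply: contraTneq xy => ->.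
  by rewrite abv0 mulr0 -leNgt abv_ge0.
have n_le1 : v n%:R <= 1 := rpred_nat (valring v) n.
pose t := x / y; have xE : x = y * t by rewrite mulrC divfK // -(abv_gt0 v).
have t_near : v (1 - t) < v n%:R ^+ 2.
  by rewrite -(ltr_pM2r y_gt0) -abvM mulrBl mul1r mulrC -xE abvBC.
have Ot : t \in valring v.
  rewrite -(subKr 1 t) rpredB ?rpred1 // valringE (le_trans (ltW t_near)) //.
  by rewrite exprn_ile1 ?abv_ge0.
pose f := 'X^n - t%:P; have Of : f \is a polyOver (valring v).
  by rewrite rpredB ?rpredX ?polyOverX ?polyOverC.
have f'1 : f^`().[1] = n%:R.
  by rewrite derivB derivXn derivC subr0 hornerMn hornerXn expr1n.
have [|w fw] := hensel Of (rpred1 _) _ v_complete.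
  by rewrite f'1 !hornerE expr1n.
rewrite f'1 => w_near; exists w; first exact: abv_near1 (lt_le_trans w_near n_le1).
by move: fw; rewrite /root !hornerE subr_eq0 => /eqP ->.
Qed.

Lemma is_power_near n x y : v (x - y) < v n%:R ^+ 2 * v y ->
  is_power n x <-> is_power n y.
Proof.
move/power_near=> [w w1 ->].
by apply: is_powerMX; rewrite -(abv_eq0 v) w1 oner_eq0.
Qed.
End PowerNear.

(** * Residues modulo p *)

Section Residue.
Variables (K : fieldType) (R : realFieldType) (v : nonarch_abv K R) (p : nat).
Hypotheses (p_pr : prime p) (vp_lt1 : v p%:R < 1).
Implicit Types (z : int) (m n : nat) (r : rat).

Lemma abv_int_le1 z : v z%:~R <= 1.
Proof. exact: (rpred_int (valring v)). Qed.

Lemma abv_int_lt1 z : (v z%:~R < 1) = (z%:~R == 0 :> 'F_p).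
Proof.
have vM_lt1 (a b : int) : v b%:~R < 1 -> v (a * b)%:~R < 1.
  move=> vb_lt1; rewrite intrM abvM (le_lt_trans _ vb_lt1) //.
  by rewrite ler_piMl ?abv_ge0 ?abv_int_le1.
rewrite -(dvdz_pcharf (pchar_Fp p_pr)).
apply/idP/idP => [|/dvdzP[q ->]]; last exact: vM_lt1.
apply: contraTT => p'z; have : coprimez z p.
  by rewrite coprimez_sym coprimezE prime_coprime.
case/coprimezP=> -[a b] /= bezout; apply/negP => vz_lt1.
suff : v 1 < 1 by rewrite abv1 ltxx.
by rewrite -[1]/(1%:~R) -bezout intrD abvD_lt // vM_lt1.
Qed.

Lemma abv_int_eq1 z : (v z%:~R == 1) = (z%:~R != 0 :> 'F_p).
Proof. by rewrite -abv_int_lt1 lt_neqAle abv_int_le1 andbT negbK. Qed.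

Lemma abv_nat_eq1 n : (v n%:R == 1) = ~~ (p %| n)%N.
Proof. by rewrite (abv_int_eq1 n) -(dvdz_pcharf (pchar_Fp p_pr)). Qed.

Lemma abv_natB_lt1 m n : (v (m%:R - n%:R) < 1) = (m%:R == n%:R :> 'F_p).
Proof.
rewrite -[_ - _]/(m%:Z%:~R - n%:Z%:~R) -intrB abv_int_lt1.
by rewrite intrB subr_eq0.
Qed.

Lemma abv_denq_eq1 r : v (ratr r) = 1 -> v (denq r)%:~R = 1.
Proof.
move=> r1; have den_neq0 : (denq r)%:~R != 0 :> K.
  apply: contra_eq_neq r1 => den0.
  by rewrite /ratr den0 invr0 mulr0 abv0 eq_sym oner_eq0.
have num_den : v (numq r)%:~R = v (denq r)%:~R.
  by rewrite -[RHS]mul1r -r1 -abvM divfK.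
apply/eqP; rewrite abv_int_eq1; apply/negP => p_den.
have p_num : (numq r)%:~R == 0 :> 'F_p by rewrite -abv_int_lt1 num_den abv_int_lt1.
move: p_num p_den; rewrite -!(dvdz_pcharf (pchar_Fp p_pr)) !dvdzE => p_num p_den.
have := dvdn_gcd p `|numq r| `|denq r|.
by rewrite p_num p_den (eqP (coprime_num_den r)) dvdn1 gtn_eqF ?prime_gt1.
Qed.

Lemma ratr_digit r : v (ratr r) = 1 -> exists d : 'F_p, v (ratr r - (d : nat)%:R) < 1.
Proof.
move=> r1; have den1 := abv_denq_eq1 r1.
have den_Fp_neq0 : (denq r)%:~R != 0 :> 'F_p by rewrite -abv_int_eq1 den1.
have den_neq0 : (denq r)%:~R != 0 :> K by rewrite -(abv_eq0 v) den1 oner_eq0.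
exists ((numq r)%:~R / (denq r)%:~R); set d := (X in nat_of_ord X).
have -> : ratr r - (d : nat)%:R
          = (numq r - denq r * (d : nat)%:Z)%:~R / (denq r)%:~R :> K.
  by rewrite /ratr intrB intrM; field.
rewrite abv_div den1 divr1 abv_int_lt1 intrB intrM.
by rewrite [X in _ * X]natr_Zp mulrC divfK ?subrr.
Qed.
End Residue.

Lemma power_residue (K : fieldType) (R : archiRealFieldType) (v : nonarch_abv K R)
    (p n d : nat) (u : K) :
    prime p -> v p%:R < 1 -> abv_complete v ->
    (forall y, v y = 1 -> exists e, v (y - e%:R) < 1) ->
    ~~ (p %| n)%N -> v u = 1 -> v (u - d%:R) < 1 ->
  is_power n u <-> is_power n (d%:R : 'F_p).
Proof.
move=> p_pr vp_lt1 v_complete digit p'n u1 ud.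
have n_gt0 : (0 < n)%N by case: n p'n; rewrite ?dvdn0.
have n1 : v n%:R = 1 by apply/eqP; rewrite (abv_nat_eq1 p_pr vp_lt1).
split=> [[y yu]|[t td]].
  have y1 : v y = 1.
    by apply/eqP; rewrite -(@pexpr_eq1 _ _ n) ?abv_ge0 // -abvX yu u1.
  have [e ye] := digit _ y1; exists e%:R.
  apply/eqP; rewrite -natrX -(abv_natB_lt1 p_pr vp_lt1) natrX.
  by rewrite -(subrKA u) abvD_lt // -yu abvBX_lt1 ?y1 // abvBC.
have tn_d : v ((t : nat)%:R ^+ n - d%:R) < 1.
  by rewrite -natrX (abv_natB_lt1 p_pr vp_lt1) natrX natr_Zp td.
have u_tn : v (u - (t : nat)%:R ^+ n) < 1.
  by rewrite -(subrKA d%:R) abvD_lt // abvBC.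
have tn1 : v ((t : nat)%:R ^+ n) = 1.
  by rewrite -u1; apply: abv_near; rewrite abvBC u1.
apply/(@is_power_near _ _ _ v_complete _ _ ((t : nat)%:R ^+ n)).
  by rewrite n1 tn1 expr1n mulr1.
by exists (t : nat)%:R.
Qed.

Lemma ratr_natV (F : unitRingType) (n : nat) : ratr n%:R^-1 = n%:R^-1 :> F.
Proof.
case: n => [|n]; first by rewrite !invr0 (ratr_nat F 0).
have n1_coprime : coprime `|1%:Z| `|n.+1%:Z| by rewrite coprime1n.
rewrite -[_^-1]mul1r /ratr -[1 / _]/(1%:~R / n.+1%:Z%:~R).
by rewrite coprimeq_num // coprimeq_den // mul1r.
Qed.

Lemma ratr_natXz (F : unitRingType) (n : nat) (k : int) :
  ratr (n%:R ^ k) = n%:R ^ k :> F.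
Proof.
case: k => k; first by rewrite -!exprnP -!natrX ratr_nat.
by rewrite NegzE -!exprnN -!natrX ratr_natV.
Qed.

(** * Powers in the field of p-adic numbers *)

Section QpPowers.
Variables (p : nat) (K : fieldType) (v : nonarch_abv K rat).
Hypotheses (v_Qp : is_Qp p v) (p_pr : prime p).
Implicit Types (x y c u : K) (n d : nat) (i j k : int).

Let p_gt0 : (0 : rat) < p%:R.
Proof. by rewrite ltr0n prime_gt0. Qed.

Lemma Qp_norm_p_lt1 : v p%:R < 1.
Proof. by rewrite (Qp_norm_p v_Qp) invf_lt1 ?ltr1n ?prime_gt1. Qed.

Lemma Qp_norm_nat_eq1 n : (v n%:R == 1) = ~~ (p %| n)%N.
Proof. exact: abv_nat_eq1 Qp_norm_p_lt1 n. Qed.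

Lemma log_norm_nat n : (0 < n)%N -> log_norm p v n%:R (- (logn p n)%:Z).
Proof.
case/(pfactor_coprime p_pr)=> m p'm {1}->; rewrite /log_norm natrM natrX abvM abvX.
have /eqP -> : v m%:R == 1 by rewrite Qp_norm_nat_eq1 -prime_coprime.
by rewrite mul1r (Qp_norm_p v_Qp) exprVn exprnN.
Qed.

Lemma log_norm_neq0 c k : log_norm p v c k -> c != 0.
Proof. by move=> ck; rewrite -(abv_gt0 v) ck exprz_gt0. Qed.

Lemma Qp_natr_neq0 n : (0 < n)%N -> n%:R != 0 :> K.
Proof. by move/log_norm_nat/log_norm_neq0. Qed.

Lemma log_norm_exists c : c != 0 -> exists k, log_norm p v c k.
Proof.
rewrite -(abv_gt0 v) => c_gt0; have [r] := Qp_dense v_Qp c c_gt0.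
rewrite abvBC => /abv_near rc; have num_gt0 : (0 < absz (numq r))%N.
  rewrite absz_gt0; apply: contraTneq c_gt0 => r0.
  by rewrite -rc /ratr r0 mul0r abv0 ltxx.
have den_gt0 : (0 < absz (denq r))%N by rewrite absz_gt0 denq_neq0.
exists (- (logn p (absz (numq r)))%:Z - - (logn p (absz (denq r)))%:Z).
rewrite /log_norm -rc /ratr abv_div !abv_absz.
rewrite (log_norm_nat num_gt0) (log_norm_nat den_gt0).
by rewrite invr_expz -expfzDr ?gt_eqF.
Qed.

Lemma log_norm_uniq c i j : log_norm p v c i -> log_norm p v c j -> i = j.
Proof.
move=> ci cj; apply: (@ieexprIz _ (p%:R : rat)); rewrite -?ci //.
by rewrite pnatr_eq1 gtn_eqF ?prime_gt1.
Qed.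

Lemma log_normX c k n : log_norm p v c k -> log_norm p v (c ^+ n) (k * n).
Proof. by rewrite /log_norm abvX => ->; rewrite exprnP exprz_exp. Qed.

Lemma unit_partE c k : log_norm p v c k -> unit_part v c = c * p%:R ^ k.
Proof. by rewrite /unit_part => ->; rewrite ratr_natXz. Qed.

Lemma norm_unit_part c : c != 0 -> v (unit_part v c) = 1.
Proof.
case/log_norm_exists=> k ck; rewrite (unit_partE ck) abvM ck abvXz.
by rewrite (Qp_norm_p v_Qp) exprz_inv -expfzDr ?gt_eqF // subrr.
Qed.

Lemma unit_digit u : v u = 1 -> exists2 d, (0 < d < p)%N & v (u - d%:R) < 1.
Proof.
move=> u1; have [r ur] := Qp_dense v_Qp u ltr01.
have r1 : v (ratr r) = 1 by rewrite -u1; apply: abv_near; rewrite u1 abvBC.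
have [d rd] := ratr_digit p_pr Qp_norm_p_lt1 r1.
have ud : v (u - (d : nat)%:R) < 1 by rewrite -(subrKA (ratr r)) abvD_lt.
have d_lt_p : (d < p)%N by rewrite -[X in (_ < X)%N](Fp_cast p_pr) ltn_ord.
exists d; rewrite // d_lt_p andbT lt0n.
by apply: contraTneq ud => ->; rewrite subr0 u1 ltxx.
Qed.

Lemma lead_digit_exists c : c != 0 -> exists d, lead_digit p v c d.
Proof. by move=> c_neq0; have [d] := unit_digit (norm_unit_part c_neq0); exists d. Qed.

Lemma Qp_power_residue n u d : ~~ (p %| n)%N -> v u = 1 -> v (u - d%:R) < 1 ->
  is_power n u <-> is_power n (d%:R : 'F_p).
Proof.
apply: (power_residue p_pr Qp_norm_p_lt1 (Qp_complete v_Qp)).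
by move=> y /unit_digit[e _ ye]; exists e.
Qed.

Lemma is_power_unit_part n c k : (0 < n)%N -> log_norm p v c k ->
  is_power n c <-> is_power n (unit_part v c) /\ (n %| k)%Z.
Proof.
move=> n_gt0 ck; have p_neq0 : p%:R != 0 :> K by rewrite Qp_natr_neq0 ?prime_gt0.
rewrite (unit_partE ck); split=> [[y yc]|[[y yc] /dvdzP[j kE]]].
  have [j yj] : exists j, log_norm p v y j.
    apply: log_norm_exists; apply: contraNneq (log_norm_neq0 ck) => y0.
    by rewrite -yc y0 expr0n (gtn_eqF n_gt0).
  have kE : k = j * n by apply: log_norm_uniq ck _; rewrite -yc; apply: log_normX.
  rewrite kE dvdz_mull //; split=> //.
  by exists (y * p%:R ^ j); rewrite exprMn yc exprnP exprz_exp.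
exists (y / p%:R ^ j).
by rewrite exprMn exprVn yc kE (exprnP (_ ^ j)) exprz_exp mulfK // expfz_neq0.
Qed.

Lemma lead_digit_powerP n c d k : ~~ (p %| n)%N ->
    lead_digit p v c d -> log_norm p v c k ->
  reflect (is_power n c)
    ((d ^ ((p - 1) %/ gcdn n (p - 1)) %% p == 1)%N && (n %| k)%Z).
Proof.
move=> p'n [/andP[d_gt0 d_lt_p] cd] ck.
have n_gt0 : (0 < n)%N by case: n p'n; rewrite ?dvdn0.
have p'd : ~~ (p %| d)%N by rewrite gtnNdvd.
apply: (equivP andP); rewrite (is_power_unit_part n_gt0 ck).
rewrite (Qp_power_residue p'n (norm_unit_part (log_norm_neq0 ck)) cd).
by rewrite (rwP (Fp_powerP p_pr n_gt0 p'd)).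
Qed.

Lemma digits_powerP n c : ~~ (p %| n)%N -> c != 0 ->
  (exists d k, [/\ lead_digit p v c d,
     (d ^ ((p - 1) %/ gcdn n (p - 1)) %% p = 1)%N, log_norm p v c k & (n %| k)%Z])
  <-> is_power n c.
Proof.
move=> p'n c_neq0; split=> [[d [k [cd d1 ck nk]]]|c_power].
  by apply/(lead_digit_powerP p'n cd ck); rewrite d1 nk.
have [d cd] := lead_digit_exists c_neq0; have [k ck] := log_norm_exists c_neq0.
by exists d, k; have /(lead_digit_powerP p'n cd ck)/andP[/eqP] := c_power.
Qed.

Lemma is_power_em n c : ~~ (p %| n)%N -> c != 0 -> is_power n c \/ ~ is_power n c.
Proof.
move=> p'n c_neq0; have [d cd] := lead_digit_exists c_neq0.
have [k ck] := log_norm_exists c_neq0.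
by case: (lead_digit_powerP p'n cd ck); [left|right].
Qed.

Hypothesis p_gt3 : (3 < p)%N.

Let p'2 : ~~ (p %| 2)%N. Proof. by rewrite gtnNdvd // (ltn_trans _ p_gt3). Qed.
Let p'3 : ~~ (p %| 3)%N. Proof. by rewrite gtnNdvd. Qed.

Lemma Qp_norm2 : v 2%:R = 1. Proof. by apply/eqP; rewrite Qp_norm_nat_eq1. Qed.
Lemma Qp_norm3 : v 3%:R = 1. Proof. by apply/eqP; rewrite Qp_norm_nat_eq1. Qed.

Lemma sqrt_existsP c : c != 0 -> sqrt_exists p v c <-> is_power 2 c.
Proof.
move=> c_neq0; rewrite -(digits_powerP p'2 c_neq0).
rewrite (gcdn_idPl (_ : 2 %| p - 1)%N); first by split=> [[]|].
by rewrite dvdn2 oddB ?prime_gt0 //; case: (even_prime p_pr) p_gt3 => [->|->].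
Qed.

Lemma sqrt_exists_em c : c != 0 -> sqrt_exists p v c \/ ~ sqrt_exists p v c.
Proof. by move=> c_neq0; rewrite (sqrt_existsP c_neq0); apply: is_power_em. Qed.

Lemma cbrt_exists_is_power c : cbrt_exists p v c -> is_power 3 c.
Proof. by case=> c_neq0; rewrite (digits_powerP p'3 c_neq0). Qed.

Lemma Qp_is_power2N3 : is_power 2 (- 3%:R : K) <-> (p %% 3 = 1)%N.
Proof.
have N3_digit : v (- 3%:R - (p - 3)%:R) < 1.
  by rewrite natrB ?(ltnW p_gt3) // opprB addKr abvN Qp_norm_p_lt1.
have nat_neq0 n : ~~ (p %| n)%N -> n%:R != 0 :> 'F_p.
  by rewrite (dvdn_pcharf (pchar_Fp p_pr)).
rewrite (Qp_power_residue p'2 _ N3_digit); last by rewrite abvN Qp_norm3.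
rewrite natrB ?(ltnW p_gt3) // (pcharf0 (pchar_Fp p_pr)) add0r.
rewrite (is_power2N3_cyclotomic (nat_neq0 _ p'2)).
rewrite (finField_cyclotomic3P (nat_neq0 _ p'3)) card_Fp // -subn1.
by rewrite -eqn_mod_dvd ?prime_gt0 //; split=> /eqP.
Qed.
End QpPowers.

(** * Roots of the cubic *)

Section RootMultiset.
Variable K : fieldType.
Implicit Types (P : {poly K}) (s t : seq K) (A B : pred K).

Lemma root_multiset_root P s x : root_multiset P s -> x \in s -> root P x.
Proof.
move=> Ps; rewrite -has_pred1 has_count Ps; apply: contraTT => /mupNroot ->.
by rewrite ltnn.
Qed.

Lemma root_multiset_perm P s t :
  root_multiset P s -> root_multiset P t -> perm_eq s t.
Proof. by move=> Ps Pt; apply/allP => x _ /=; rewrite Ps Pt. Qed.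

Lemma solvable_inE P s A n : root_multiset P s ->
  solvable_in P A n <-> size s = n /\ all A s.
Proof.
move=> Ps; split=> [[t [Pt [<- At]]]|[sn As]]; last by exists s.
have st := root_multiset_perm Ps Pt.
by rewrite (perm_size st) (perm_all A st).
Qed.

Lemma solvable_in2E P s A n B m : root_multiset P s ->
  solvable_in2 P A n B m <-> count A s = n /\ count B s = m.
Proof.
move=> Ps; split=> [[t [Pt [<- <-]]]|[sn As]]; last by exists s.
by rewrite !(seq.permP (root_multiset_perm Ps Pt)).
Qed.
End RootMultiset.

Section Cubic.
Variable K : fieldType.
Implicit Types (a b r x y : K).

Lemma horner_cubic a b x : (cubic a b).[x] = x ^+ 3 + a * x - b.
Proof. by rewrite /cubic !hornerE. Qed.

Lemma horner_deriv_cubic a b x : (cubic a b)^`().[x] = 3%:R * x ^+ 2 + a.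
Proof.
rewrite /cubic derivB derivD derivXn derivM derivX !derivC mul0r add0r mulr1 subr0.
by rewrite hornerD hornerMn hornerXn hornerC mulr_natl.
Qed.

Lemma root_cubicE a b x : root (cubic a b) x = (x ^+ 3 + a * x == b).
Proof. by rewrite /root horner_cubic subr_eq0. Qed.

Lemma cubic_cofactor a b r : root (cubic a b) r ->
  cubic a b = ('X - r%:P) * ('X^2 + r%:P * 'X + (r ^+ 2 + a)%:P).
Proof.
rewrite root_cubicE => /eqP <-; rewrite /cubic !polyCD !polyC_exp polyCM; ring.
Qed.

Definition cofactor_disc a r : K := r ^+ 2 - 4%:R * (r ^+ 2 + a).

Lemma root_multiset_cubic3 a b r y : 2%:R != 0 :> K ->
    root (cubic a b) r -> y ^+ 2 = cofactor_disc a r ->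
  root_multiset (cubic a b) [:: r; (y - r) / 2%:R; (- y - r) / 2%:R].
Proof.
move=> nz2 Pr y2 x; rewrite -mu_prod_XsubC !big_cons big_nil mulr1.
rewrite (cubic_cofactor Pr); congr (mup x (_ * _)).
set s := (y - r) / _; set t := (- y - r) / _.
have -> : r = - (s + t) by rewrite /s /t; field.
have -> : (- (s + t)) ^+ 2 + a = s * t.
  have -> : a = - (y ^+ 2 + 3%:R * r ^+ 2) / 2%:R / 2%:R.
    by rewrite y2 /cofactor_disc; field.
  by rewrite /s /t; field.
by move: s t => s t; rewrite polyCN polyCM polyCD; ring.
Qed.

Lemma root_multiset_cubic1 a b r : root (cubic a b) r ->
  ~ is_power 2 (cofactor_disc a r) -> root_multiset (cubic a b) [:: r].
Proof.
move=> Pr nsq x; rewrite -mu_prod_XsubC big_seq1 (cubic_cofactor Pr) mupMl //.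
apply/negP; rewrite /root !hornerE => /eqP x_root; apply: nsq.
exists (2%:R * x + r).
have -> : (2%:R * x + r) ^+ 2
          = 4%:R * (x ^+ 2 + r * x + r ^+ 2 + a) + cofactor_disc a r.
  by rewrite /cofactor_disc; ring.
by rewrite x_root mulr0 add0r.
Qed.

Lemma cubic_root_multiset a b r (splits : bool) : 2%:R != 0 :> K ->
    root (cubic a b) r -> (is_power 2 (cofactor_disc a r) <-> splits) ->
  exists s, [/\ root_multiset (cubic a b) (r :: s),
    size s = if splits then 2 else 0
    & {in s, forall x, (2%:R * x + r) ^+ 2 = cofactor_disc a r}].
Proof.
move=> nz2 Pr; case: splits => -[disc_splits splits_disc]; last first.
  by exists [::]; split=> //; apply: root_multiset_cubic1 => // /disc_splits.
have [y y2] := splits_disc isT; exists [:: (y - r) / 2%:R; (- y - r) / 2%:R].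
split=> //; first exact: root_multiset_cubic3.
by move=> x; rewrite !inE -y2 => /orP[]/eqP->; field.
Qed.
End Cubic.

Section NonarchCubic.
Variables (K : fieldType) (R : archiRealFieldType) (v : nonarch_abv K R).
Implicit Types (a b r x y : K).

Lemma abv_root_cubic a b x : v a ^+ 3 < v b ^+ 2 -> root (cubic a b) x ->
  v x ^+ 3 = v b.
Proof.
move=> ab; rewrite root_cubicE => /eqP xb; have [ax|xa] := ltP (v a) (v x ^+ 2).
  have x_gt0 : 0 < v x by rewrite abv_gt0 (abvX_gt_neq0 (abv_ge0 v a) ax).
  rewrite -abvX -xb addrC; apply/esym/abvD_dominant.
  by rewrite abvM abvX (exprSr _ 2) ltr_pM2r.
have b_le : v b <= v a * v x.
  by rewrite -xb abvD_le ?abvX ?abvM // (exprSr _ 2) ler_wpM2r ?abv_ge0.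
have : v b ^+ 2 <= v a ^+ 3.
  apply: (@le_trans _ _ ((v a * v x) ^+ 2)).
    by rewrite lerXn2r ?nnegrE ?mulr_ge0 ?abv_ge0.
  by rewrite exprMn (exprSr _ 2) ler_wpM2l // exprn_ge0 ?abv_ge0.
by rewrite leNgt ab.
Qed.

Hypothesis v_complete : abv_complete v.

Lemma cubic_root_cube a y : v 3%:R = 1 -> v a < v y ^+ 2 ->
  exists2 r, root (cubic a (y ^+ 3)) r & v r = v y.
Proof.
move=> v3 ay; have y_neq0 := abvX_gt_neq0 (abv_ge0 v a) ay.
have c_lt1 : v (a / y ^+ 2) < 1.
  by rewrite abv_div abvX ltr_pdivrMr ?mul1r ?exprn_gt0 ?abv_gt0.
pose f := cubic (a / y ^+ 2) 1; have Of : f \is a polyOver (valring v).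
  rewrite /f /cubic rpredB ?rpredD ?rpredM ?rpredX ?polyOverX ?polyOverC ?rpred1 //.
  by rewrite valringE ltW.
have f1 : f.[1] = a / y ^+ 2 by rewrite horner_cubic expr1n mulr1 addrC addKr.
have f'1 : v f^`().[1] = 1.
  by rewrite horner_deriv_cubic expr1n mulr1 addrC abvD_dominant v3.
have [|z fz] := hensel Of (rpred1 _) _ v_complete; rewrite f'1 ?f1 ?expr1n // => z_near.
exists (y * z); last by rewrite abvM (abv_near1 z_near) mulr1.
move: fz; rewrite !root_cubicE => /eqP fz.
by rewrite -[_ ^+ 3 in X in _ == X]mulr1 -fz; apply/eqP; field.
Qed.

Lemma cubic_root_linear a b : v b ^+ 2 < v a ^+ 3 ->
  exists2 r, root (cubic a b) r & v r = v b / v a.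
Proof.
move=> ba; have a_neq0 := abvX_gt_neq0 (exprn_ge0 2 (abv_ge0 v b)) ba.
pose e := b ^+ 2 / a ^+ 3; have e_lt1 : v e < 1.
  by rewrite abv_div !abvX ltr_pdivrMr ?mul1r ?exprn_gt0 ?abv_gt0.
pose f := e%:P * 'X^3 + 'X - 1%:P; have Of : f \is a polyOver (valring v).
  rewrite rpredB ?rpredD ?rpredM ?rpredX ?polyOverX ?polyOverC ?rpred1 //.
  by rewrite valringE ltW.
have fE x : f.[x] = e * x ^+ 3 + x - 1.
  by rewrite hornerD hornerN hornerD hornerCM hornerXn hornerX hornerC.
have f1 : f.[1] = e by rewrite fE expr1n mulr1 addrK.
have f'1 : v f^`().[1] = 1.
  have -> : f^`().[1] = e * 3%:R + 1.
    rewrite derivB derivD derivM derivXn derivX !derivC mul0r add0r subr0.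
    by rewrite hornerD hornerCM hornerMn hornerXn hornerC expr1n.
  rewrite abvD_dominant abv1 // abvM (le_lt_trans _ e_lt1) // ler_piMr ?abv_ge0 //.
  exact: (rpred_nat (valring v)).
have [|z fz] := hensel Of (rpred1 _) _ v_complete; rewrite f'1 ?f1 ?expr1n // => z_near.
exists (b / a * z); last by rewrite abvM abv_div (abv_near1 z_near) mulr1.
move: fz; rewrite root_cubicE /root fE subr_eq0 => /eqP fz.
by rewrite -[X in _ == X]mulr1 -fz; apply/eqP; rewrite /e; field.
Qed.
End NonarchCubic.

(** * Solvability from the norms of the roots *)

Section RootPattern.
Variables (K : fieldType) (R : realFieldType) (v : nonarch_abv K R).
Implicit Types (P : {poly K}) (A B : pred K) (C D : pred R) (splits : bool).
Implicit Types (c d : R) (x : K).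

Definition norm_power c x : Prop := exists2 n, (0 < n)%N & v x ^+ n = c.

(* The norms |b|^(1/3) and |a|^(1/2) of the roots are known through their powers
   only, which is enough to compare them with 1. *)
Definition root_pattern P splits c d : Prop :=
  exists r s, [/\ root_multiset P (r :: s), size s = if splits then 2 else 0,
    norm_power c r & {in s, forall x, norm_power d x}].

Definition norm_class A C : Prop := forall x n, (0 < n)%N -> A x = C (v x ^+ n).

Lemma norm_classE A C c x : norm_class A C -> norm_power c x -> A x = C c.
Proof. by move=> A_class [n n_gt0 <-]; apply: A_class. Qed.

Lemma root_pattern_count P splits c d : root_pattern P splits c d ->
  exists s, [/\ root_multiset P s, size s = if splits then 3 else 1
    & forall A C, norm_class A C ->
      count A s = (C c + C d * if splits then 2 else 0)%N].
Proof.
case=> r [s [Ps size_s rc sd]]; exists (r :: s).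
split=> // [|A C A_class] /=; first by rewrite size_s; case: (splits).
rewrite (norm_classE A_class rc) (eq_in_count (a2 := fun=> C d)); last first.
  by move=> x /sd; apply: norm_classE.
by rewrite -size_s; case: (C d); rewrite ?count_predT ?count_pred0 ?mul1n.
Qed.

Lemma solvable_in3_pattern P splits c d A C :
    root_pattern P splits c d -> norm_class A C ->
  solvable_in P A 3 <-> [&& splits, C c & C d].
Proof.
case/root_pattern_count=> s [Ps size_s countE] A_class.
rewrite (solvable_inE _ _ Ps) all_count (countE _ _ A_class) size_s.
by case: splits {Ps size_s countE}; case: (C c); case: (C d) => //=; split=> // -[].
Qed.

Lemma solvable_in1_pattern P splits c d A C :
    root_pattern P splits c d -> norm_class A C ->
  solvable_in P A 1 <-> ~~ splits && C c.
Proof.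
case/root_pattern_count=> s [Ps size_s countE] A_class.
rewrite (solvable_inE _ _ Ps) all_count (countE _ _ A_class) size_s.
by case: splits {Ps size_s countE}; case: (C c); case: (C d) => //=; split=> // -[].
Qed.

Lemma solvable_in2_pattern P splits c d A B C D :
    root_pattern P splits c d -> norm_class A C -> norm_class B D ->
    (forall e, ~~ (C e && D e)) ->
  solvable_in2 P A 1 B 2 <-> [&& splits, C c & D d].
Proof.
case/root_pattern_count=> s [Ps _ countE] A_class B_class CD_disjoint.
rewrite (solvable_in2E _ _ _ _ Ps) (countE _ _ A_class) (countE _ _ B_class).
move: (CD_disjoint c) (CD_disjoint d); case: splits {Ps countE};
by case: (C c); case: (C d); case: (D c); case: (D d) => //= *; split=> [[]|].
Qed.
End RootPattern.

Section NormClasses.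
Variables (K : fieldType) (v : nonarch_abv K rat).
Implicit Types (P : {poly K}) (splits : bool) (c d : rat).

Lemma Zp_units_class : norm_class v (Zp_units v) (fun e => e == 1).
Proof. by move=> x n n_gt0; rewrite pexpr_eq1 ?abv_ge0. Qed.

Lemma Zp_nonunits_class : norm_class v (Zp_nonunits v) (fun e => e < 1).
Proof. by move=> x n n_gt0; rewrite expr_lt1 ?abv_ge0. Qed.

Lemma Qp_nonint_class : norm_class v (Qp_nonint v) (fun e => 1 < e).
Proof. by move=> x n n_gt0; rewrite expr_gt1 ?abv_ge0. Qed.

Lemma solvable_in2_nonunits_units P splits c d : root_pattern v P splits c d ->
  solvable_in2 P (Zp_nonunits v) 1 (Zp_units v) 2 <-> [&& splits, c < 1 & d == 1].
Proof.
move/solvable_in2_pattern/(_ Zp_nonunits_class Zp_units_class); apply=> e.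
by case: ltgtP.
Qed.

Lemma solvable_in2_units_nonint P splits c d : root_pattern v P splits c d ->
  solvable_in2 P (Zp_units v) 1 (Qp_nonint v) 2 <-> [&& splits, c == 1 & 1 < d].
Proof.
move/solvable_in2_pattern/(_ Zp_units_class Qp_nonint_class); apply=> e.
by case: ltgtP.
Qed.

Lemma solvable_in2_nonunits_nonint P splits c d : root_pattern v P splits c d ->
  solvable_in2 P (Zp_nonunits v) 1 (Qp_nonint v) 2 <-> [&& splits, c < 1 & 1 < d].
Proof.
move/solvable_in2_pattern/(_ Zp_nonunits_class Qp_nonint_class); apply=> e.
by case: ltgtP.
Qed.
End NormClasses.

Section QpCubic.
Variables (p : nat) (K : fieldType) (v : nonarch_abv K rat).
Hypotheses (v_Qp : is_Qp p v) (p_pr : prime p) (p_gt3 : (3 < p)%N).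
Implicit Types (a b x y : K).

Let v_complete : abv_complete v := Qp_complete v_Qp.
Let v2 : v 2%:R = 1 := Qp_norm2 v_Qp p_pr p_gt3.
Let v3 : v 3%:R = 1 := Qp_norm3 v_Qp p_pr p_gt3.
Let nz2 : 2%:R != 0 :> K := Qp_natr_neq0 v_Qp p_pr (isT : 0 < 2)%N.

Lemma is_square_near x y : v (x - y) < v y -> is_power 2 x <-> is_power 2 y.
Proof. by move=> xy; apply: (is_power_near v_complete); rewrite v2 expr1n mul1r. Qed.

Lemma cofactor_disc_squareP a r : v a < v r ^+ 2 ->
  is_power 2 (cofactor_disc a r) <-> (p %% 3 = 1)%N.
Proof.
move=> ar; have r_neq0 := abvX_gt_neq0 (abv_ge0 v a) ar.
rewrite -(Qp_is_power2N3 v_Qp p_pr p_gt3) -(is_powerMX 2 (- 3%:R) r_neq0).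
apply: is_square_near.
have -> : cofactor_disc a r - - 3%:R * r ^+ 2 = - (4%:R * a).
  by rewrite /cofactor_disc; ring.
rewrite abvN [v (4%:R * a)]abvM [v (_ * r ^+ 2)]abvM abvN v3 mul1r abvX.
rewrite (le_lt_trans _ ar) // ler_piMl ?abv_ge0 //.
exact: (rpred_nat (valring v)).
Qed.

Lemma cofactor_disc_near a r : v r ^+ 2 < v a ->
  v (cofactor_disc a r - (- a * 2%:R ^+ 2)) < v (- a * 2%:R ^+ 2).
Proof.
move=> ra; have -> : cofactor_disc a r - (- a * 2%:R ^+ 2) = - 3%:R * r ^+ 2.
  by rewrite /cofactor_disc; ring.
rewrite [v (_ * r ^+ 2)]abvM [v (- a * _)]abvM !abvX !abvN v3 v2.
by rewrite expr1n mul1r mulr1.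
Qed.

Lemma Delta1_pattern a b : Delta1 p v a b ->
  root_pattern v (cubic a b) (p %% 3 == 1)%N (v b) (v b).
Proof.
case=> ab /(cbrt_exists_is_power v_Qp p_pr p_gt3)[y yb].
have ay : v a < v y ^+ 2.
  rewrite -(ltr_pXn2r (n := 3)) ?nnegrE ?exprn_ge0 ?abv_ge0 //.
  by rewrite exprAC -[v y ^+ 3]abvX yb.
have [r] := cubic_root_cube v_complete v3 ay; rewrite yb => Pr ry.
have discE : is_power 2 (cofactor_disc a r) <-> (p %% 3 == 1)%N.
  by rewrite -(rwP eqP); apply: cofactor_disc_squareP; rewrite ry.
have [s [Ps size_s _]] := cubic_root_multiset nz2 Pr discE.
have norm_root x : x \in r :: s -> norm_power v (v b) x.
  by move/(root_multiset_root Ps)/(abv_root_cubic ab); exists 3.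
exists r, s; split=> // [|x xs]; apply: norm_root; rewrite inE ?eqxx //.
by rewrite xs orbT.
Qed.

Lemma Delta3_neq0 a b : Delta3 v a b -> a != 0.
Proof. exact: abvX_gt_neq0 (exprn_ge0 2 (abv_ge0 v b)). Qed.

Lemma Delta3_lt a b : Delta3 v a b -> v a <= 1 -> v b < v a.
Proof.
move=> ba a_le1; rewrite -(ltr_pXn2r (n := 2)) ?nnegrE ?abv_ge0 //.
by apply: lt_le_trans ba _; rewrite exprS ler_piMl ?exprn_ge0 ?abv_ge0.
Qed.

Lemma Delta3_pattern a b : Delta3 v a b ->
  exists2 splits : bool, sqrt_exists p v (- a) <-> splits
                       & root_pattern v (cubic a b) splits (v b / v a) (v a).
Proof.
move=> ba; have [r Pr vr] := cubic_root_linear v_complete ba.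
have Na_neq0 : - a != 0 by rewrite oppr_eq0 (Delta3_neq0 ba).
have a_gt0 : 0 < v a by rewrite -abvN abv_gt0.
have ra : v r ^+ 2 < v a by rewrite vr expr_div_n ltr_pdivrMr ?exprn_gt0 // -exprS.
have [splits sqrtE] : exists splits : bool, sqrt_exists p v (- a) <-> splits.
  by case: (sqrt_exists_em v_Qp p_pr p_gt3 Na_neq0); [exists true|exists false].
have discE : is_power 2 (cofactor_disc a r) <-> splits.
  rewrite -sqrtE (sqrt_existsP v_Qp p_pr p_gt3 Na_neq0) -(is_powerMX 2 (- a) nz2).
  exact: is_square_near (cofactor_disc_near ra).
have [s [Ps size_s s_disc]] := cubic_root_multiset nz2 Pr discE.
exists splits => //; exists r, s; split=> // [|x xs].
  by exists 1%N; rewrite ?expr1.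
have norm_2xr : v (2%:R * x + r) ^+ 2 = v a.
  rewrite -abvX s_disc // (abv_near (cofactor_disc_near ra)).
  by rewrite abvM abvX v2 expr1n mulr1 abvN.
have r_lt : v r < v (2%:R * x + r).
  by rewrite -(ltr_pXn2r (n := 2)) ?nnegrE ?abv_ge0 // norm_2xr.
exists 2 => //; rewrite -norm_2xr -[v x]mul1r -v2 -abvM; congr (_ ^+ 2).
by rewrite -{1}[2%:R * x](addrK r) addrC abvD_dominant ?abvN.
Qed.
End QpCubic.

Lemma is_Qp_abv (p : nat) (K : fieldType) (nK : K -> rat) :
  is_Qp p nK -> exists v : nonarch_abv K rat, nK = v.
Proof.
by case=> nK_ge0 nK_eq0 nKM nKD *; exists (NonarchAbv nK_ge0 nK_eq0 nKM nKD).
Qed.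

Theorem mainTheorem1 (p : nat) (K : fieldType) (nK : K -> rat)
  (HK : is_Qp p nK) (hp : prime p) (hp3 : (3 < p)%N)
  (a b : K) (hab : a * b != 0)
  (hD : Delta1 p nK a b \/ Delta3 nK a b) :
  let P := cubic a b in
  let U := Zp_units nK in
  let M := Zp_nonunits nK in
  let O := Qp_nonint nK in
  ((* 1 *)
      solvable_in P U 3 <->
        Delta1 p nK a b /\ nK b = 1 /\ (p %% 3 = 1)%N) /\
  ((* 2 *)
      solvable_in P M 3 <->
        (Delta1 p nK a b /\ nK b < 1 /\ (p %% 3 = 1)%N) \/
        (Delta3 nK a b /\ nK a < 1 /\ sqrt_exists p nK (- a))) /\
  ((* 3 *)
      solvable_in P O 3 <->
        (Delta1 p nK a b /\ 1 < nK b /\ (p %% 3 = 1)%N) \/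
        (Delta3 nK a b /\ nK a < nK b /\ sqrt_exists p nK (- a))) /\
  ((* 4 *)
      solvable_in2 P M 1 U 2 <->
        Delta3 nK a b /\ nK a = 1 /\ sqrt_exists p nK (- a)) /\
  ((* 5 *)
      solvable_in2 P U 1 O 2 <->
        Delta3 nK a b /\ nK a = nK b /\ sqrt_exists p nK (- a)) /\
  ((* 6 *)
      solvable_in2 P M 1 O 2 <->
        Delta3 nK a b /\ nK b < nK a /\ 1 < nK a /\ sqrt_exists p nK (- a)) /\
  ((* 7 *)
      solvable_in P U 1 <->
        (Delta1 p nK a b /\ nK b = 1 /\ (p %% 3 = 2)%N) \/
        (Delta3 nK a b /\ nK a = nK b /\ ~ sqrt_exists p nK (- a))) /\
  ((* 8 *)
      solvable_in P M 1 <->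
        (Delta1 p nK a b /\ nK b < 1 /\ (p %% 3 = 2)%N) \/
        (Delta3 nK a b /\ nK b < nK a /\ ~ sqrt_exists p nK (- a))) /\
  ((* 9 *)
      solvable_in P O 1 <->
        (Delta1 p nK a b /\ 1 < nK b /\ (p %% 3 = 2)%N) \/
        (Delta3 nK a b /\ nK a < nK b /\ ~ sqrt_exists p nK (- a))).
Proof.
have [v nKE] := is_Qp_abv HK; subst nK => P U M O.
have solvableE splits c d (pat : root_pattern v P splits c d) :=
  (solvable_in3_pattern pat (Zp_units_class v),
   solvable_in3_pattern pat (Zp_nonunits_class v),
   solvable_in3_pattern pat (Qp_nonint_class v),
   solvable_in1_pattern pat (Zp_units_class v),
   solvable_in1_pattern pat (Zp_nonunits_class v),
   solvable_in1_pattern pat (Qp_nonint_class v), solvable_in2_nonunits_units pat,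
   solvable_in2_units_nonint pat, solvable_in2_nonunits_nonint pat).
case: hD => D.
  have notD3 : ~ Delta3 v a b by case: D => /lt_trans ab _ /ab; rewrite ltxx.
  rewrite !(solvableE _ _ _ (Delta1_pattern HK hp hp3 D)) (prime_mod3_eq2 hp hp3).
  rewrite (rwP (@eqP _ (v b) 1)).
  by case: eqP; case: ltgtP => /=; intuition done.
have notD1 : ~ Delta1 p v a b by case=> /lt_trans ab _; move: D => /ab; rewrite ltxx.
have [splits sqrtE pat] := Delta3_pattern HK hp hp3 D.
have a_gt0 : 0 < v a by rewrite abv_gt0 (Delta3_neq0 D).
rewrite !(solvableE _ _ _ pat) sqrtE divr_eq1 ?(gt_eqF a_gt0) // (eq_sym (v b)).
rewrite ltr_pdivrMr // ltr_pdivlMr // mul1r.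
rewrite (rwP (@eqP _ (v a) 1)) (rwP (@eqP _ (v a) (v b))).
move: (Delta3_lt D); case: splits {sqrtE pat}; case: (ltgtP (v a) 1);
  case: (ltgtP (v a) (v b)) => //= _ _ lt_ba; intuition done.
Qed.
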